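(* $B(1.39,p)$ cannot be true for infinitely many primes $p$. In other words, for all sufficiently large primes $p$ there is a non-empty subset $S\subseteq GF(p)$ with $|X_S(GF(p))|>1.39\,p$.
   Context: For an odd prime $p$ and a non-empty subset $S\subseteq GF(p)$ let $f_S(x)=\prod_{a\in S}(x-a)\in GF(p)[x]$, and let $X_S$ be the hyperelliptic curve $y^2=f_S(x)$. $|X_S(GF(p))|$ denotes the number of solutions $(x,y)\in GF(p)^2$ of $y^2=f_S(x)$ plus the number of points at infinity, which is $2$ if $|S|$ is even and $1$ if $|S|$ is odd. For a real number $c$, $B(c,p)$ is the statement: for all non-empty subsets $S\subseteq GF(p)$, $|X_S(GF(p))|\le c\cdot p$. *)

(* Defs.v *)
From HB Require Import structures.
From mathcomp Require Import all_boot all_order all_algebra.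
From mathcomp Require Import all_classical all_reals.

Set Implicit Arguments.
Unset Strict Implicit.
Unset Printing Implicit Defensive.

Import Order.TTheory GRing.Theory Num.Theory.

Local Open Scope ring_scope.

(* 'F_p is the field with p elements only when p is prime; the curve below is
   hyperelliptic with the stated points at infinity only when p is odd. *)
Definition fS (p : nat) (S : {set 'F_p}) : {poly 'F_p} :=
  \prod_(a in S) ('X - a%:P).

Definition XS_affine (p : nat) (S : {set 'F_p}) : {set 'F_p * 'F_p} :=
  [set P : 'F_p * 'F_p | P.2 ^+ 2 == (fS S).[P.1]].

Definition XS_infinity (p : nat) (S : {set 'F_p}) : nat :=
  if odd #|S| then 1%N else 2%N.

Definition XS_card (p : nat) (S : {set 'F_p}) : nat :=
  (#|XS_affine S| + XS_infinity S)%N.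

Definition B (R : realType) (c : R) (p : nat) : Prop :=
  forall S : {set 'F_p}, S != finset.set0 -> (XS_card S)%:R <= c * p%:R.

(* Main.v *)
(** Fix the two extensions of the quadratic character of [F_p] obtained by giving
    it the value [1] or [-1] at [0].  Multiplying their translates over [S] gives
    [2 p] signs attached to [S], multiplicative under symmetric difference of
    sets, and the average of the two signs at [x] is the quadratic character of
    [f_S(x)].  The sum of the [2 p] signs of [S] is thus [2 N - 2 p], where [N] is
    the number of affine points of [X_S], so that a set with many points is a
    codeword of small weight in a binary linear code of length [2 p] and
    dimension [p].  Plotkin's argument produces one: by the pigeonhole principle
    eight subsets of [F_p] have the same signs at [p - 3] given coordinates, and
    averaging over the symmetric differences of pairs of them gives one with
    [N >= (10 p - 12) / 7], and [10 / 7 > 1.39]. *)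

Require Import Defs.
From HB Require Import structures.
From mathcomp Require Import all_boot all_order all_fingroup all_algebra all_solvable.
From mathcomp Require Import all_classical all_reals.
From mathcomp Require Import zify ring.

Local Open Scope ring_scope.

Set Implicit Arguments.
Unset Strict Implicit.
Unset Printing Implicit Defensive.

Import Order.TTheory GRing.Theory Num.Theory.

(** * Plotkin's averaging argument for binary words *)

Lemma pigeonhole (T S : finType) (f : T -> S) (A : {set S}) (k : nat) :
  (forall x, f x \in A) -> (k * #|A| < #|T|)%N ->
  exists y, (k < #|[set x | f x == y]|)%N.
Proof.
move=> fA ltk; apply/existsP; apply: contraLR ltk => /existsPn le_k.
rewrite -leqNgt.
rewrite -(sum1_card T) (partition_big f (mem A)) => [|x _]; last exact: fA.
rewrite mulnC -sum_nat_const; apply: leq_sum => y _.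
by rewrite sum1dep_card leqNgt; exact: le_k.
Qed.

Lemma exists_subset_card (T : finType) (A : {set T}) (k : nat) :
  (k <= #|A|)%N -> exists2 B : {set T}, B \subset A & #|B| = k.
Proof.
move=> /card_geqP[s [us <- sA]]; exists [set x in s].
  by apply/fintype.subsetP => x; rewrite inE; exact: sA.
by rewrite cardsE; exact/card_uniqP.
Qed.

(** Take [k.+1] words agreeing on [m] coordinates and sum the correlations over all ordered pairs:
    the total is at least [k.+1 ^ 2 * m]. Removing the diagonal, [k.+1 * #|J|], and averaging over
    the [k.+1 * k] remaining pairs gives the bound. *)
Lemma plotkin (T J : finType) (c : T -> J -> bool) (k m : nat) :
    (0 < k)%N -> (m <= #|J|)%N -> (k * 2 ^ m < #|T|)%N ->
  exists U V, U != V /\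
    (k.+1 * m)%:Z - #|J|%:Z <= k%:Z * \sum_j (-1) ^+ (c U j (+) c V j).
Proof.
move=> k_gt0 le_m ltk.
have [M _ cardM] : exists2 M : {set J}, M \subset [set: J] & #|M| = m.
  by apply: exists_subset_card; rewrite cardsT.
pose sig U := [set j in M | c U j].
have [y] : exists y, (k < #|[set U | sig U == y]|)%N.
  apply: (@pigeonhole _ _ sig (powerset M)) => [U|]; last first.
    by rewrite card_powerset cardM.
  by rewrite inE; apply/fintype.subsetP => j; rewrite inE => /andP[].
move=> /exists_subset_card[P /fintype.subsetP Py cardP].
have cM U V j : U \in P -> V \in P -> j \in M -> c U j = c V j.
  move=> /Py; rewrite inE => /eqP sU /Py; rewrite inE => /eqP sV jM.
  by have := congr1 (fun X : {set J} => j \in X) (etrans sU (esym sV));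
    rewrite !inE jM.
pose D U V : int := \sum_j (-1) ^+ (c U j (+) c V j).
have Ddiag U : D U U = #|J|%:Z.
  rewrite /D (eq_bigr (fun=> 1)) => [|j _]; last by rewrite addbb.
  by rewrite sumr_const natz.
have lower : (k.+1 * (k.+1 * m))%:Z <= \sum_(U in P) \sum_(V in P) D U V.
  rewrite /D; under eq_bigr do rewrite exchange_big /=.
  rewrite exchange_big /= (bigID (mem M)) /= -[leLHS]addr0; apply: lerD.
    rewrite (eq_bigr (fun=> (k.+1 * k.+1)%:Z)) => [|j jM].
      by rewrite sumr_const cardM -mulr_natr; lia.
    rewrite (eq_bigr (fun=> (k.+1)%:Z)) => [|U UP].
      by rewrite sumr_const cardP -mulr_natr; lia.
    rewrite (eq_bigr (fun=> 1)) => [|V VP].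
      by rewrite sumr_const cardP natz.
    by rewrite (cM U V) // addbb.
  (* Outside [M], the double sum at [j] is the square of a sum of signs. *)
  apply: sumr_ge0 => j _.
  under eq_bigr do under eq_bigr do rewrite signr_addb.
  under eq_bigr do rewrite -mulr_sumr.
  by rewrite -mulr_suml -expr2 sqr_ge0.
have [/existsP[U /existsP[V /andP[UV h]]]|] :=
  boolP [exists U, exists V, (U != V) && ((k.+1 * m)%:Z - #|J|%:Z <= k%:Z * D U V)].
  by exists U, V.
move=> /existsPn noU.
have upper U V : U != V -> k%:Z * D U V <= (k.+1 * m)%:Z - #|J|%:Z - 1.
  by move=> UV; have /existsPn/(_ V) := noU U; rewrite UV /= -ltNge; lia.
have rowub U : U \in P -> k%:Z * \sum_(V in P) D U V <=
    k%:Z * (k.+1 * m)%:Z - k%:Z.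
  move=> UP; rewrite (bigD1 U) //= Ddiag mulrDr mulr_sumr.
  have -> : k%:Z * (k.+1 * m)%:Z - k%:Z =
     k%:Z * #|J|%:Z + k%:Z * ((k.+1 * m)%:Z - #|J|%:Z - 1) by ring.
  rewrite lerD2l.
  have -> : k%:Z * ((k.+1 * m)%:Z - #|J|%:Z - 1) =
      \sum_(V in P | V != U) ((k.+1 * m)%:Z - #|J|%:Z - 1).
    rewrite sumr_const -mulr_natl natz; congr (Posz _ * _).
    have := cardD1 U (mem P); rewrite cardP UP => -[->].
    by apply: eq_card => V; rewrite !inE andbC.
  by apply: ler_sum => V /andP[_ VU]; rewrite upper // eq_sym.
have := ler_sum (index_enum T) rowub.
rewrite -mulr_sumr sumr_const cardP -mulr_natr natz.
have := ler_wpM2l (ler0n int k) lower; rewrite natz.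
set S := \sum_(_ in P) _ => lowS upS; exfalso.
(* The lower bound [lowS] exceeds the upper bound [upS] by exactly this product. *)
have : 0 < k%:Z * k.+1%:Z by rewrite mulr_gt0.
move: (le_trans lowS upS); rewrite !PoszM mulrBl.
have -> : k%:Z * (k.+1%:Z * (k.+1%:Z * m%:Z)) =
  k%:Z * (k.+1%:Z * m%:Z) * k.+1%:Z by ring.
lia.
Qed.

(** * Quadratic character of a finite field, as sign bits *)

Section QuadraticCharacter.
Variable F : finFieldType.
Implicit Types (x y a c : F) (e : bool) (U V : {set F}).

Definition is_square c := [exists y : F, y ^+ 2 == c].

Lemma is_squareMl x y : x != 0 -> is_square x -> is_square (x * y) = is_square y.
Proof.
move=> x0 /existsP[a /eqP xE]; move: x0; rewrite -{}xE expf_eq0 /= => a0.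
apply/existsP/existsP => -[b /eqP bE].
  by exists (b / a); rewrite expr_div_n bE mulrC mulKf // expf_eq0.
by exists (a * b); rewrite exprMn bE.
Qed.

(* A product of two odd powers of a generator of the cyclic group of units is an
   even power. *)
Lemma is_squareM_non x y : x != 0 -> y != 0 ->
  ~~ is_square x -> ~~ is_square y -> is_square (x * y).
Proof.
have /cyclicP[g gE] := field_unit_group_cyclic [set: {unit F}]%G.
have powP z : z != 0 -> exists i, z = FinRing.uval g ^+ i.
  rewrite -unitfE => uz; have /cycleP[i zi] : FinRing.Unit uz \in <[g]>%g.
    by rewrite -gE inE.
  by exists i; have := congr1 FinRing.uval zi; rewrite FinRing.val_unitX.
have oddP z : z != 0 -> ~~ is_square z ->
    exists i, z = FinRing.uval g ^+ (i.*2.+1).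
  move=> /powP[i ->] nsq; exists i./2; congr (_ ^+ _).
  rewrite -[LHS]odd_double_half; case: (boolP (odd i)) => //= /negPf evi.
  case/negP: nsq; apply/existsP; exists (FinRing.uval g ^+ i./2).
  by rewrite -exprM muln2 -[in X in _ == X](odd_double_half i) evi.
move=> x0 y0 /(oddP _ x0)[i ->] /(oddP _ y0)[j ->].
apply/existsP; exists (FinRing.uval g ^+ (i + j).+1).
by rewrite -exprM -exprD; apply/eqP; congr (_ ^+ _); lia.
Qed.

(* The sign bit of the quadratic character, extended by the bit [e] at [0]. *)
Definition quad_sign e c := if c == 0 then e else ~~ is_square c.

Lemma quad_signM e x y : x != 0 -> y != 0 ->
  quad_sign e (x * y) = quad_sign e x (+) quad_sign e y.
Proof.
move=> x0 y0; rewrite /quad_sign mulf_eq0 (negPf x0) (negPf y0) /=.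
have [sx|nx] := boolP (is_square x); first by rewrite is_squareMl.
have [sy|ny] := boolP (is_square y); first by rewrite mulrC is_squareMl // nx.
by rewrite is_squareM_non.
Qed.

(** For nonzero [c] both signs are the character of [c]; at [0] they cancel, leaving the single
    root. *)
Lemma card_sqrt c : (2 : F) != 0 ->
  2 * #|[set y | y ^+ 2 == c]|%:Z =
  2 + (-1) ^+ quad_sign false c + (-1) ^+ quad_sign true c.
Proof.
move=> two_neq0; rewrite /quad_sign; have [->|c0] := eqVneq c 0.
  have -> : [set y : F | y ^+ 2 == 0] = [set 0].
    by apply/setP => y; rewrite !inE expf_eq0.
  by rewrite cards1.
have [/existsP[y /eqP yE]|nsq] := boolP (is_square c).
  have -> : [set z | z ^+ 2 == c] = [set y; - y].
    by apply/setP => z; rewrite !inE -yE eqf_sqr.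
  rewrite cards2; suff -> : y != - y by [].
  rewrite -addr_eq0 -mulr2n -mulr_natl mulf_neq0 //.
  by apply: contraNneq c0 => y0; rewrite -yE y0 expr0n.
have -> : [set y | y ^+ 2 == c] = finset.set0.
  apply/setP => y; rewrite !inE; apply: contraNF nsq => yc.
  by apply/existsP; exists y.
by rewrite cards0.
Qed.

Definition set_sign e U x := \big[addb/false]_(a in U) quad_sign e (x - a).

(** A common element contributes its bit twice, hence nothing. This holds even at [x = a], because
    the extended character is a sign there rather than [0]. *)
Lemma set_sign_symdiff e U V x :
  set_sign e [set a | (a \in U) (+) (a \in V)] x =
  set_sign e U x (+) set_sign e V x.
Proof.
rewrite /set_sign [in RHS]big_mkcond [X in _ (+) X]big_mkcond -big_split /=.
rewrite [LHS]big_mkcond; apply: eq_bigr => a _; rewrite inE.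
by do 2 case: (_ \in _) => //=; rewrite ?addbF ?addbb.
Qed.

Lemma quad_sign_prod e (I : finType) (P : pred I) (f : I -> F) :
  (forall i, P i -> f i != 0) ->
  quad_sign e (\prod_(i | P i) f i) = \big[addb/false]_(i | P i) quad_sign e (f i).
Proof.
move=> f0.
(* Nonvanishing is carried along because [quad_signM] needs it. *)
suff [] : \prod_(i | P i) f i != 0 /\
  quad_sign e (\prod_(i | P i) f i) = \big[addb/false]_(i | P i) quad_sign e (f i) by [].
elim/big_ind2 : _ => [|x b y b' [x0 <-] [y0 <-]|i Pi].
- split; first exact: oner_neq0.
  rewrite /quad_sign oner_eq0; apply/negbTE; rewrite negbK.
  by apply/existsP; exists 1; rewrite expr1n.
- by rewrite mulf_neq0 // quad_signM.
- by split; first exact: f0.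
Qed.

Lemma set_sign_prod U x :
  (-1) ^+ set_sign false U x + (-1) ^+ set_sign true U x =
  (-1) ^+ quad_sign false (\prod_(a in U) (x - a)) +
  (-1) ^+ quad_sign true (\prod_(a in U) (x - a)) :> int.
Proof.
rewrite /set_sign; have [xU|xU] := boolP (x \in U).
  have /eqP prod0 : \prod_(a in U) (x - a) == 0.
    by apply/prodf_eq0; exists x => //; rewrite subrr.
  rewrite prod0 (bigD1 x) //= [in X in _ + X](bigD1 x) //=.
  rewrite subrr /quad_sign eqxx /=.
  (* Only the factor at [a = x] depends on [e], so the two signs are opposite and both sides
     vanish. *)
  set b := (X in (-1) ^+ nat_of_bool X + _); set b' := (X in ~~ X).
  have -> : b' = b.
    apply: eq_bigr => a /andP[_ ax].
    by rewrite subr_eq0 eq_sym (negPf ax).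
  by case: b.
rewrite !quad_sign_prod // => a aU; rewrite subr_eq0.
all: by apply: contraNneq xU => ->.
Qed.

End QuadraticCharacter.

(** * Point counts on the curves *)

Lemma card_XS_affine (p : nat) (S : {set 'F_p}) : (2 : 'F_p) != 0 ->
  2 * #|XS_affine S|%:Z =
  2 * #|'F_p|%:Z + \sum_(j : 'F_p * bool) (-1) ^+ set_sign j.2 S j.1.
Proof.
move=> two_neq0.
have -> : #|XS_affine S|%:Z =
    \sum_(x : 'F_p) #|[set y | y ^+ 2 == \prod_(a in S) (x - a)]|%:Z.
  rewrite /XS_affine -sum1dep_card.
  rewrite -(pair_big_dep xpredT (fun x y => y ^+ 2 == (fS S).[x])
    (fun _ _ => 1%N)) /= -natz natr_sum.
  apply: eq_bigr => x _; rewrite natz sum1dep_card; congr (Posz _).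
  apply: eq_card => y; rewrite !inE /fS horner_prod.
  by under eq_bigr do rewrite hornerXsubC.
rewrite mulr_sumr; under eq_bigr do rewrite card_sqrt // -addrA -set_sign_prod.
rewrite big_split /=; congr (_ + _).
  by rewrite sumr_const -[LHS]mulr_natr natz.
apply: etrans (pair_bigA _ (fun x e => (-1) ^+ set_sign e S x)).
by apply: eq_bigr => x _; rewrite big_bool addrC.
Qed.

Lemma exists_many_points (p : nat) : prime p -> odd p ->
  exists2 S : {set 'F_p}, S != finset.set0 & (10 * p <= 7 * #|XS_affine S| + 12)%N.
Proof.
move=> p_prime p_odd.
have p_gt2 := odd_prime_gt2 p_odd p_prime.
have two_neq0 : (2 : 'F_p) != 0.
  rewrite -(dvdn_pcharf (pchar_Fp p_prime)) dvdn_prime2 //.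
  by rewrite neq_ltn p_gt2 orbT.
have cardJ : #|{: 'F_p * bool}| = (p * 2)%N.
  by rewrite card_prod card_bool card_Fp.
have cardT : #|{set 'F_p}| = (2 ^ p)%N.
  by rewrite -cardsT -powersetT card_powerset cardsT card_Fp.
(* Here [7 * 2 ^ (p - 3) < 2 ^ p], and the sign sum [s] obtained satisfies
   [8 * (p - 3) - 2 * p <= 7 * s]. *)
have [|||U [V [UV]]] := @plotkin {set 'F_p} ('F_p * bool)%type
    (fun U j => set_sign j.2 U j.1) 7 (p - 3).
- by [].
- by rewrite cardJ; lia.
- rewrite cardT -[X in (_ < 2 ^ X)%N](subnK p_gt2) expnD mulnC.
  by rewrite ltn_pmul2l ?expn_gt0.
rewrite cardJ; under eq_bigr do rewrite -set_sign_symdiff.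
set W := [set a | _] => sum_ge.
exists W.
  apply: contraNneq UV => W0; apply/eqP/setP => a.
  by move/setP/(_ a): W0; rewrite !inE; do 2 case: (_ \in _).
have := card_XS_affine W two_neq0; rewrite card_Fp // => cardW.
by move: sum_ge cardW; set s := \sum_j _; lia.
Qed.

Local Open Scope classical_set_scope.

Theorem theorem6 (R : realType) :
  ~ infinite_set [set p : nat | [/\ prime p, odd p & B (139 / 100 : R) p]]
  /\ exists N : nat, forall p : nat, prime p -> odd p -> (N <= p)%N ->
       exists S : {set 'F_p}, S != finset.set0 /\
         (139 / 100 : R) * p%:R < (XS_card S)%:R.
Proof.
(* The affine points suffice once [973 * p < 1000 * p - 1200], that is, from [p = 45] on. *)
have many p : prime p -> odd p -> (45 <= p)%N ->
    exists S : {set 'F_p}, S != finset.set0 /\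
      (139 / 100 : R) * p%:R < (XS_card S)%:R.
  move=> p_prime p_odd p_ge; have [S S0 hS] := exists_many_points p_prime p_odd.
  exists S; split=> //.
  rewrite mulrAC ltr_pdivrMr ?ltr0n // -!natrM ltr_nat /XS_card; lia.
split; last by exists 45%N.
apply; apply: (@sub_finite_set _ _ `I_45); last exact: finite_II.
move=> p /= [p_prime p_odd pB]; rewrite ltnNge; apply/negP => p_ge.
have [S [S0]] := many p p_prime p_odd p_ge.
by rewrite ltNge pB.
Qed.
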